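(* Let $S\in M_N(\mathbb{C})$ be nilpotent of degree $D\ge2$. Let $$\Gamma=\Big\{\theta\in M_N(\mathbb{C}[x])\ \Big|\ P_0(x\theta(x))=P_0(\theta(0)x),\quad P_0(x^j\theta(x))=0\ \ (j\ge2),\quad \sum_{k=0}^{q}(-1)^kS^{k+D-q-1}P_k(\theta)=0\ \ (0\le q\le D-1)\Big\}.$$ Then $\Gamma=\mathbb{A}$. Moreover, for each $\theta$ we have an explicit expression for the operator $\mathcal{B}$ (that is, for the operator $\mathcal{B}=\mathcal{B}(z,\partial_z)$ with $(\psi\mathcal{B})(x,z)=\theta(x)\psi(x,z)$).
   Context: $S$ nilpotent of degree $D$ means $S^D=0$, $S^{D-1}\neq0$; $S^0=I$ is the $N\times N$ identity matrix; $[X,Y]=XY-YX$. For $k\in\mathbb{N}=\{0,1,2,\dots\}$ and $\theta\in M_N(\mathbb{C}[x])$, $$P_k(\theta)=\frac{\theta^{(k+1)}(0)}{k!}-\sum_{j=k+2}^{k+D}(-1)^{k-j}\Big[\frac{\theta^{(j)}(0)}{j!},S^{j-k-1}\Big].$$ The matrix valued function $\psi$ is $\psi(x,z)=e^{xz}\big(Iz+\sum_{m=1}^{D}(-1)^mS^{m-1}x^{-m}\big)$. A linear matrix differential operator $\mathcal{B}=\mathcal{B}(z,\partial_z)=\sum_{j=0}^{m}\partial_z^j\cdot b_j(z)$, with coefficients $b_j$ meromorphic $N\times N$ matrix valued functions on a suitable open subset of $\mathbb{C}$, acts on $\psi$ from the right by $\psi\mathcal{B}=\sum_{j=0}^{m}(\partial_z^j\psi)\,b_j(z)$.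 Finally $$\mathbb{A}=\{\theta\in M_N(\mathbb{C}[x])\mid \exists\,\mathcal{B}=\mathcal{B}(z,\partial_z):\ (\psi\mathcal{B})(x,z)=\theta(x)\psi(x,z)\}.$$ *)

(* Defs.v *)
From mathcomp Require Import all_boot all_order all_algebra.
From mathcomp Require Import complex.
From mathcomp Require Import all_classical all_reals all_analysis.

Set Implicit Arguments.
Unset Strict Implicit.
Unset Printing Implicit Defensive.

Import Order.TTheory GRing.Theory Num.Theory.
Import numFieldNormedType.Exports.

Local Open Scope classical_set_scope.
Local Open Scope ring_scope.
Local Open Scope complex_scope.

(* R[i], repackaged so that it gets the topology and the normed-module
   structure that the analysis library puts on every numFieldType; in
   particular derivable and derive1n are complex derivatives on it. *)
Definition complexField (R : realType) : numClosedFieldType := R[i].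

Section Definitions.
Variables (R : realType).
Local Notation C := (complexField R).

Definition expC (z : C) : C :=
  (expR (complex.Re z) * cos (complex.Im z))
    +i* (expR (complex.Re z) * sin (complex.Im z)).

Definition holomorphic_at (f : C -> C) (z : C) : Prop :=
  \forall w \near z, derivable f w 1.

(* Meromorphic functions are total functions whose values at the poles are
   irrelevant: only a punctured neighbourhood of each point is constrained. *)
Definition meromorphic_at (f : C -> C) (z : C) : Prop :=
  exists (n : nat) (g : C -> C),
    holomorphic_at g z /\ \forall w \near z^', f w = g w / (w - z) ^+ n.

Variable N : nat.

Definition mx_holomorphic_at (F : C -> 'M[C]_N) (z : C) : Prop :=
  forall i k, holomorphic_at (fun w => F w i k) z.

Definition mx_meromorphic_at (F : C -> 'M[C]_N) (z : C) : Prop :=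
  forall i k, meromorphic_at (fun w => F w i k) z.

Definition mx_derive (j : nat) (F : C -> 'M[C]_N) (z : C) : 'M[C]_N :=
  \matrix_(i, k) derive1n j (fun w => F w i k) z.

(* The operator \sum_(j <= op_order) (d/dz)^j . b_j(z); the function
   op_coef is meaningful only up to index op_order. *)
Record diffop := DiffOp {
  op_dom : set C;
  op_order : nat;
  op_coef : nat -> C -> 'M[C]_N
}.

Definition coefficient (B : diffop) (j : nat) (z : C) : 'M[C]_N :=
  if (j <= op_order B)%N then op_coef B j z else 0.

Definition meromorphic_op (B : diffop) : Prop :=
  [/\ open (op_dom B), op_dom B !=set0 &
      forall j, (j <= op_order B)%N ->
        forall z, op_dom B z -> mx_meromorphic_at (op_coef B j) z].

Definition regular_point (B : diffop) (z : C) : Prop :=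
  op_dom B z /\
  forall j, (j <= op_order B)%N -> mx_holomorphic_at (op_coef B j) z.

(* Action from the right: the coefficients multiply on the right. *)
Definition ract (F : C -> C -> 'M[C]_N) (B : diffop) (x z : C) : 'M[C]_N :=
  \sum_(0 <= j < (op_order B).+1) mx_derive j (F x) z *m op_coef B j z.

Definition nilpotent_of_degree (S : 'M[C]_N) (D : nat) : Prop :=
  S ^+ D = 0 /\ S ^+ D.-1 <> 0.

Definition commutator (X Y : 'M[C]_N) : 'M[C]_N := X *m Y - Y *m X.

Definition mxeval (theta : 'M[{poly C}]_N) (x : C) : 'M[C]_N :=
  map_mx (fun p : {poly C} => p.[x]) theta.

Definition mxderiv0 (theta : 'M[{poly C}]_N) (j : nat) : 'M[C]_N :=
  map_mx (fun p : {poly C} => p^`(j).[0]) theta.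

Variables (S : 'M[C]_N) (D : nat).

Definition P (k : nat) (theta : 'M[{poly C}]_N) : 'M[C]_N :=
  k`!%:R^-1 *: mxderiv0 theta k.+1
  - \sum_(k.+2 <= j < (k + D).+1)
      (-1) ^ (k%:Z - j%:Z) *:
        commutator (j`!%:R^-1 *: mxderiv0 theta j) (S ^+ (j - k - 1)).

Definition psi (x z : C) : 'M[C]_N :=
  expC (x * z) *:
    (z%:M + \sum_(1 <= m < D.+1) ((-1) ^+ m * x ^- m) *: S ^+ m.-1).

(* psi B = theta psi, as an identity between functions that are meromorphic
   in z: it is tested where psi and all the coefficients of B are defined. *)
Definition intertwines (B : diffop) (theta : 'M[{poly C}]_N) : Prop :=
  forall x z, x != 0 -> regular_point B z ->
    ract psi B x z = mxeval theta x *m psi x z.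

Definition bispectral_algebra : set 'M[{poly C}]_N :=
  [set theta | exists B : diffop, meromorphic_op B /\ intertwines B theta].

Definition Gamma : set 'M[{poly C}]_N :=
  [set theta |
    [/\ P 0 ('X *: theta) = P 0 ('X *: map_mx polyC (mxeval theta 0)),
        forall j, (2 <= j)%N -> P 0 ('X^j *: theta) = 0 &
        forall q, (q <= D - 1)%N ->
          \sum_(0 <= k < q.+1)
             (-1) ^+ k *: (S ^+ (k + D - q - 1) *m P k theta) = 0]].

(* 1 + the degree of theta, and 0 for theta = 0 *)
Definition mxsize (theta : 'M[{poly C}]_N) : nat :=
  \max_(i < N) \max_(k < N) size (theta i k).

(* Put P(x) = \sum_k P_k(theta) x^k and b(x, z) = \sum_j b_j(z) x^j.  The sum
   in psi is - (x + S)^-1, so psi B = theta psi reads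
     theta (z - (x + S)^-1) = (z - (x + S)^-1) b + db/dx,
   whose polynomial part is, for c := b - theta,
     z c + dc/dx - [polynomial part of (x + S)^-1 c] = - P.
   When P = (x + S) Q with Q a polynomial, its solution is
     c = - (x + S) \sum_(i >= 0) (-1)^i z^(-i-1) (d/dx)^i Q
       = - \sum_(i >= 0) (-1)^i z^(-i-1) (P^(i) - i Q^(i-1)),
   and Q = \sum_j x^j \sum_(0 <= m < D) (-1)^m S^m P_(j+1+m)(theta).  The
   formula below collects the coefficient of x^j; the terms with
   i >= mxsize theta vanish. *)
Definition explicit_coef (theta : 'M[{poly C}]_N) (j : nat) (z : C)
    : 'M[C]_N :=
  j`!%:R^-1 *: mxderiv0 theta j - z^-1 *: P j theta
  + \sum_(1 <= i < mxsize theta)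
      ((-1) ^+ i.+1 * z ^- i.+1 * ((j + i).-1`!%:R / j`!%:R)) *:
        (j%:R *: P (j + i) theta
         - i%:R *: \sum_(1 <= m < D)
                     (-1) ^+ m *: (S ^+ m *m P (j + i + m) theta)).

Definition explicit_op (theta : 'M[{poly C}]_N) : diffop :=
  DiffOp [set z : C | z != 0] (mxsize theta).-1 (explicit_coef theta).

End Definitions.

(* Main.v *)
Require Import Defs.
From mathcomp Require Import all_boot all_order all_algebra.
From mathcomp Require Import complex.
From mathcomp Require Import all_classical all_reals all_analysis.
From mathcomp Require Import ring lra zify.
Import Order.TTheory GRing.Theory Num.Theory.
Import numFieldNormedType.Exports.
Local Open Scope classical_set_scope.
Local Open Scope ring_scope.
Set Implicit Arguments.
Unset Strict Implicit.

(** Differentiating psi in z and cancelling the exponential turns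
    psi B = theta psi, at a fixed z, into an identity between Laurent
    polynomials in x:

      (z + A) b + db/dx = theta (z + A),   A(x) = - (x + S)^-1,

    where b(x) = sum_j b_j(z) x^j and A is the finite sum in psi.  With
    c := b - theta this reads

      z c + A c + dc/dx = - (dtheta/dx + [A, theta]),

    and comparing coefficients of x splits it in two ([intertwines_coefs]):
    - the nonnegative powers give z c + T c = - P, where T is d/dx followed by
      addition of the polynomial part of A c, and the coefficients of P are the
      P_k(theta);
    - the negative powers give (A c)_- = - [A, theta]_-.

    The operator T lowers degrees.  So for z != 0 the first equation has exactly
    one polynomial solution, c = - sum_i (-1)^i z^(-i-1) T^i P
    ([coef_solution_unique]); this already gives the uniqueness of B.

    If B exists, the second equation holds at infinitely many z, because
    meromorphic coefficients are holomorphic near every point with that point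
    removed.  It is then an identity between polynomials in z^-1, whose
    coefficients of degree 0 and 1 are [A, theta]_- = 0 and (A P)_- = 0
    ([solution_obstruction]).  Written out, these two conditions are the ones
    that define Gamma ([GammaP]).

    Conversely, (A P)_- = 0 says that P = (x + S) Q with Q a polynomial.  Since
    T ((x + S) Q) = (x + S) dQ/dx ([lowering_lin_mul]), every T^i P is again a
    multiple of x + S, hence (A c)_- = 0 and both equations hold ([solutionP]).
    The same identity puts T^i P in closed form ([iter_loweringE]), which gives
    the explicit coefficients of B. *)

(** * Laurent polynomials with vector coefficients *)

Section LaurentSums.
Variables (F : fieldType) (V : lmodType F).
Implicit Types (f : nat -> V) (h : nat -> nat -> V).

Lemma sum_trunc f (p n : nat) : (p <= n)%N -> (forall j, (p <= j)%N -> f j = 0) ->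
  \sum_(0 <= j < n) f j = \sum_(0 <= j < p) f j.
Proof.
move=> pn f0; rewrite (@big_cat_nat _ _ _ p) //= [X in _ + X]big_nat.
by rewrite [X in _ + X]big1 ?addr0 // => j /andP[/f0].
Qed.

Lemma sum_shift_down f (n m : nat) (x : F) : x != 0 ->
  (forall j, (n <= j)%N -> f j = 0) ->
  \sum_(0 <= j < n) (x ^+ j * x ^- m) *: f j =
  \sum_(0 <= k < n) x ^+ k *: f (k + m)%N
    + \sum_(1 <= r < m.+1) x ^- r *: f (m - r)%N.
Proof.
move=> x0 f0.
have -> : \sum_(0 <= j < n) (x ^+ j * x ^- m) *: f j =
          \sum_(0 <= j < n + m) (x ^+ j * x ^- m) *: f j.
  apply/esym/sum_trunc; rewrite ?leq_addr // => j nj.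
  by rewrite f0 ?scaler0.
rewrite (@big_cat_nat _ _ _ m) ?leq_addl //= addrC; congr (_ + _).
  rewrite -[X in \sum_(X <= _ < _) _](add0n m) big_addn addnK.
  by apply: eq_bigr => k _; rewrite exprD mulfK // expf_neq0.
rewrite big_nat_rev /= [RHS]big_add1 /= big_nat [RHS]big_nat.
apply: eq_bigr => r /= rm; rewrite add0n; congr (_ *: _).
by rewrite -[in X in _ / X](subnK rm) exprD invfM mulrA divff ?mul1r ?expf_neq0.
Qed.

Lemma exchange_triangle (D : nat) h :
  \sum_(1 <= m < D.+1) \sum_(1 <= r < m.+1) h m r =
  \sum_(1 <= r < D.+1) \sum_(r <= m < D.+1) h m r.
Proof.
have -> : \sum_(1 <= m < D.+1) \sum_(1 <= r < m.+1) h m r =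
  \sum_(1 <= m < D.+1) \sum_(1 <= r < D.+1 | (r <= m)%N) h m r.
  by apply: eq_big_nat => m /andP[_ mD]; rewrite (big_nat_widen _ _ D.+1).
rewrite (exchange_big_dep_nat xpredT) //=.
apply: eq_big_nat => r /andP[r1 _].
by rewrite [RHS](big_nat_widenl _ 1).
Qed.

(** The product of a polynomial and a polynomial in x^-1, split into its
    nonnegative and its negative powers of x.  The two factors enter only
    through the products [h m j] of their coefficients, so that the lemma
    applies to left and to right multiplication alike. *)
Lemma laurent_split h (n D : nat) (x : F) : x != 0 ->
  (forall m j, (n <= j)%N -> h m j = 0) ->
  \sum_(0 <= j < n) x ^+ j *: \sum_(1 <= m < D.+1) x ^- m *: h m j =
  \sum_(0 <= k < n) x ^+ k *: (\sum_(1 <= m < D.+1) h m (k + m)%N)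
    + \sum_(1 <= r < D.+1) x ^- r *: (\sum_(r <= m < D.+1) h m (m - r)%N).
Proof.
move=> x0 h0.
under eq_bigr do rewrite scaler_sumr.
rewrite exchange_big_nat /=.
under eq_bigr => m _.
  under eq_bigr do rewrite scalerA.
  rewrite sum_shift_down //; last by move=> j; apply: h0.
  over.
rewrite big_split /= exchange_triangle; congr (_ + _).
  by rewrite exchange_big_nat /=; apply: eq_bigr => k _; rewrite scaler_sumr.
by apply: eq_bigr => r _; rewrite scaler_sumr.
Qed.

End LaurentSums.

Lemma power_sum_eq0 (F : fieldType) (p q n : nat) (e : nat -> 'M[F]_(p, q))
    (u : nat -> F) : injective u ->
  (forall k, \sum_(0 <= i < n) u k ^+ i *: e i = 0) ->
  forall i, (i < n)%N -> e i = 0.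
Proof.
move=> u_inj e0 i i_n; apply/matrixP => a b; rewrite [RHS]mxE.
pose f : {poly F} := \poly_(l < n) e l a b.
suff f0 : f = 0.
  by have := congr1 (fun g : {poly F} => g`_i) f0; rewrite coef_poly i_n coef0.
have fu k : root f (u k).
  rewrite /root horner_poly -(big_mkord xpredT (fun l => e l a b * u k ^+ l)).
  have /(congr1 (fun A : 'M[F]_(p, q) => A a b)) := e0 k.
  rewrite [RHS]mxE summxE => H0; apply/eqP; rewrite -[RHS]H0.
  by apply: eq_bigr => j _; rewrite mxE mulrC.
apply/eqP/negPn/negP => f_neq0.
pose rs := [seq u k | k <- iota 0 (size f)].
suff : (size rs < size f)%N by rewrite size_map size_iota ltnn.
apply: max_poly_roots => //; first by apply/allP => _ /mapP[k _ ->].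
by rewrite map_inj_uniq // iota_uniq.
Qed.

Lemma laurent_eq0 (F : numFieldType) (p q n D : nat) (E G : nat -> 'M[F]_(p, q)) :
  (forall x : F, x != 0 ->
    \sum_(0 <= k < n) x ^+ k *: E k + \sum_(1 <= r < D.+1) x ^- r *: G r = 0) ->
  (forall k, (k < n)%N -> E k = 0) /\
  (forall r, (1 <= r <= D)%N -> G r = 0).
Proof.
move=> H.
pose c k := if (k < D)%N then G (D - k)%N else E (k - D)%N.
have c0 k : (k < D + n)%N -> c k = 0.
  apply: (power_sum_eq0 (u := fun l => l.+1%:R)) => [a b /eqP | l].
    by rewrite eqr_nat => /eqP[].
  have : l.+1%:R != 0 :> F by rewrite pnatr_eq0.
  move: (l.+1%:R) => x x0.
  have := congr1 (fun A => x ^+ D *: A) (H x x0).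
  rewrite scaler0 scalerDr !scaler_sumr; apply: etrans.
  rewrite (@big_cat_nat _ _ _ D) ?leq_addr //= addrC; congr (_ + _).
    rewrite -[X in \sum_(X <= _ < _) _](add0n D) big_addn addKn.
    apply: eq_bigr => a _; rewrite /c ltnNge leq_addl /= addnK.
    by rewrite scalerA -exprD addnC.
  rewrite big_nat_rev /= [RHS]big_add1 /= !big_nat; apply: eq_bigr => r /= rD.
  rewrite /c add0n ltn_subrL /= (leq_ltn_trans _ rD) // subKn // scalerA.
  by rewrite -[in RHS](subnK rD) exprD mulfK // expf_neq0.
split=> [k kn | r /andP[r1 rD]].
  have := c0 (D + k)%N; rewrite /c ltn_add2l => /(_ kn).
  by rewrite ltnNge leq_addr /= addKn.
have D0 : (0 < D)%N by apply: leq_trans rD.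
have DrD : (D - r < D)%N by rewrite ltn_subrL r1.
by have := c0 (D - r)%N; rewrite /c DrD subKn // ltn_addr //; apply.
Qed.

(** * The degree-lowering operator *)

(** Matrix polynomials c(x) = sum_k c_k x^k are handled as their sequences of
    coefficients; no bound on the support is built in. *)
Section Lowering.
Variables (F : numFieldType) (N D : nat) (S : 'M[F]_N).
Local Notation M := 'M[F]_N.
Implicit Types (c d p q : nat -> M) (z : F).

Lemma natr_fact_neq0 k : k`!%:R != 0 :> F.
Proof. by rewrite pnatr_eq0 -lt0n fact_gt0. Qed.

(** With A(x) = sum_(1 <= m <= D) (-1)^m x^-m S^(m-1), which is - (x + S)^-1
    when S^D = 0, these are the coefficients of x^k and of x^-r in A c. *)
Definition tail_mul_pos c (k : nat) : M :=
  \sum_(1 <= m < D.+1) (-1) ^+ m *: (S ^+ m.-1 *m c (k + m)%N).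

Definition tail_mul_neg c (r : nat) : M :=
  \sum_(r <= m < D.+1) (-1) ^+ m *: (S ^+ m.-1 *m c (m - r)%N).

Definition deriv_seq c (k : nat) : M := k.+1%:R *: c k.+1.

Definition lowering c (k : nat) : M := deriv_seq c k + tail_mul_pos c k.

Lemma deriv_seq0 c : deriv_seq c 0 = c 1%N.
Proof. exact: scale1r. Qed.

Lemma eq_tail_mul_neg c d : c =1 d -> tail_mul_neg c =1 tail_mul_neg d.
Proof. by move=> cd r; apply: eq_bigr => m _; rewrite cd. Qed.

(** Only the coefficients beyond k enter the k-th one of the image: this is the
    form in which the operator lowers degrees. *)
Lemma lowering_ext c d k : (forall j, (k < j)%N -> c j = d j) ->
  lowering c k = lowering d k.
Proof.
move=> cd; rewrite /lowering /deriv_seq cd //; congr (_ + _).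
by apply: eq_big_nat => m /andP[m1 _]; rewrite cd // -addn1 leq_add2l.
Qed.

Lemma eq_iter_lowering c d i : c =1 d -> iter i lowering c =1 iter i lowering d.
Proof.
by move=> cd; elim: i => //= i IHi k; apply: lowering_ext => j _; apply: IHi.
Qed.

Lemma lowering_sum (n : nat) (a : nat -> F) (c : nat -> nat -> M) k :
  lowering (fun j => \sum_(0 <= i < n) a i *: c i j) k =
  \sum_(0 <= i < n) a i *: lowering (c i) k.
Proof.
rewrite /lowering /deriv_seq /tail_mul_pos.
under [RHS]eq_bigr do rewrite scalerDr scaler_sumr.
rewrite big_split /= scaler_sumr; congr (_ + _).
  by apply: eq_bigr => i _; rewrite !scalerA mulrC.
rewrite exchange_big_nat; apply: eq_bigr => m _.
rewrite mulmx_sumr scaler_sumr; apply: eq_bigr => i _.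
by rewrite -scalemxAr !scalerA mulrC.
Qed.

Lemma tail_mul_neg_sum (n : nat) (a : nat -> F) (c : nat -> nat -> M) r :
  tail_mul_neg (fun j => \sum_(0 <= i < n) a i *: c i j) r =
  \sum_(0 <= i < n) a i *: tail_mul_neg (c i) r.
Proof.
rewrite /tail_mul_neg.
under [RHS]eq_bigr do rewrite scaler_sumr.
rewrite exchange_big_nat; apply: eq_bigr => m _.
rewrite mulmx_sumr scaler_sumr; apply: eq_bigr => i _.
by rewrite -scalemxAr !scalerA mulrC.
Qed.

(** Two polynomials with the same image agree in every degree, by descending
    induction: once the higher coefficients agree, only z times the current one
    is left. *)
Lemma add_lowering_inj z c d (n : nat) : z != 0 ->
  (forall k, (n <= k)%N -> c k = 0) -> (forall k, (n <= k)%N -> d k = 0) ->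
  (forall k, z *: c k + lowering c k = z *: d k + lowering d k) -> c =1 d.
Proof.
move=> z0 cn dn cd k.
have H i j : (n <= j + i)%N -> c j = d j.
  elim: i j => [|i IHi] j nj; first by rewrite addn0 in nj; rewrite cn ?dn.
  have /lowering_ext T : forall l, (j < l)%N -> c l = d l.
    by move=> l jl; apply: IHi; lia.
  have := cd j; rewrite T => /addIr /(congr1 (fun X => z^-1 *: X)).
  by rewrite !scalerA mulVf // !scale1r.
by apply: (H n); rewrite leq_addl.
Qed.

(** The Neumann series of - (z + T)^-1, cut at a length n beyond which the
    powers of the degree-lowering operator T vanish on p. *)
Definition resolvent (n : nat) z p (k : nat) : M :=
  \sum_(0 <= i < n) ((-1) ^+ i.+1 * z ^- i.+1) *: iter i lowering p k.

Lemma iter_lowering0 p (n i k : nat) : (forall k, (n <= k)%N -> p k = 0) ->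
  (n <= k + i)%N -> iter i lowering p k = 0.
Proof.
move=> pn; elim: i k => [|i IHi] k nk /=; first by rewrite addn0 in nk; apply: pn.
rewrite /lowering /deriv_seq IHi ?scaler0 ?add0r; last lia.
rewrite /tail_mul_pos big_nat big1 // => m /andP[m1 _].
by rewrite IHi ?mulmx0 ?scaler0 //; lia.
Qed.

Lemma resolvent0 p (n k : nat) z : (forall k, (n <= k)%N -> p k = 0) ->
  (n <= k)%N -> resolvent n z p k = 0.
Proof.
move=> pn nk; rewrite /resolvent big1 // => i _.
by rewrite (iter_lowering0 pn) ?scaler0 // (leq_trans nk) ?leq_addr.
Qed.

Lemma resolventP p (n : nat) z k : z != 0 -> (forall k, (n <= k)%N -> p k = 0) ->
  z *: resolvent n z p k + lowering (resolvent n z p) k = - p k.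
Proof.
move=> z0 pn; rewrite {2}/resolvent lowering_sum scaler_sumr -big_split /=.
rewrite (telescope_sumr_eq (fun i => ((-1) ^+ i * z ^- i) *: iter i lowering p k)) //.
  by rewrite (iter_lowering0 pn) ?leq_addl // scaler0 sub0r expr0 invr1 mulr1 scale1r.
move=> i _; rewrite scalerA addrC /=; congr (_ + _).
by rewrite -scaleNr; congr (_ *: _); rewrite !exprS invfM; field; rewrite z0 expf_neq0.
Qed.

(** * Multiples of x + S *)

(** Left multiplication by x + S. *)
Definition lin_mul q (k : nat) : M :=
  (if k is k'.+1 then q k' else 0) + S *m q k.

Hypothesis SD0 : S ^+ D = 0.

Lemma expmx_mul m (X : M) : S ^+ m *m (S *m X) = S ^+ m.+1 *m X.
Proof. by rewrite mulmxA -[S ^+ m *m S]/(S ^+ m * S) -exprSr. Qed.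

Lemma mul_expmx m (X : M) : S *m (S ^+ m *m X) = S ^+ m.+1 *m X.
Proof. by rewrite mulmxA -[S *m S ^+ m]/(S * S ^+ m) -exprS. Qed.

(** This lemma and the next express A (x + S) q = - q. *)
Lemma tail_mul_pos_lin_mul q k : tail_mul_pos (lin_mul q) k = - q k.
Proof.
rewrite /tail_mul_pos big_add1 /=.
rewrite (telescope_sumr_eq (fun m => (-1) ^+ m *: (S ^+ m *m q (k + m)%N))) //.
  by rewrite SD0 mul0mx scaler0 sub0r !expr0 scale1r mul1mx addn0.
move=> m _; rewrite addnS /= mulmxDr expmx_mul addrC scalerDr.
by rewrite [in X in _ + X]exprS mulN1r scaleNr.
Qed.

Lemma tail_mul_neg_lin_mul q r : (1 <= r <= D)%N -> tail_mul_neg (lin_mul q) r = 0.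
Proof.
move=> /andP[r1 rD]; rewrite /tail_mul_neg.
(* At m = r the telescoping term would involve the coefficient of index -1. *)
rewrite (telescope_sumr_eq (fun m =>
  if m == r then 0 else (-1) ^+ m.-1 *: (S ^+ m.-1 *m q (m - r).-1))) ?leqW //.
  by rewrite eqxx gtn_eqF //= SD0 mul0mx scaler0 subr0.
move=> m /andP[rm _]; rewrite gtn_eqF //= subSn //= /lin_mul mulmxDr scalerDr addrC.
have m0 : (0 < m)%N by apply: leq_trans rm.
rewrite expmx_mul prednK //; congr (_ + _).
case: eqVneq => [->|neq_mr]; first by rewrite subnn mulmx0 scaler0 oppr0.
have /subnSK : (r < m)%N by rewrite ltn_neqAle eq_sym neq_mr.
move=> <- /=; rewrite -scaleNr; congr (_ *: _).
by rewrite -{1}(prednK m0) exprS mulN1r.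
Qed.

(** The polynomial part of (x + S)^-1 p. *)
Definition lin_quot p (j : nat) : M :=
  \sum_(0 <= m < D) (-1) ^+ m *: (S ^+ m *m p (j + m).+1).

(** Divisibility by x + S is decided by the coefficient of x^-1 in A p alone:
    up to sign, it is the remainder p(-S) of the left division. *)
Lemma lin_mulK p k : tail_mul_neg p 1 = 0 -> lin_mul (lin_quot p) k = p k.
Proof.
move=> p1; rewrite /lin_mul.
pose f j m := - ((-1) ^+ m *: (S ^+ m *m p (j + m)%N)).
have fE j : f j D - f j 0 = p j.
  by rewrite /f SD0 mul0mx scaler0 oppr0 sub0r opprK !expr0 scale1r mul1mx addn0.
have SqE j : S *m lin_quot p j =
    \sum_(0 <= m < D) (-1) ^+ m *: (S ^+ m.+1 *m p (j + m).+1).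
  by rewrite mulmx_sumr; apply: eq_bigr => m _; rewrite -scalemxAr mul_expmx.
have fS j m : f j m.+1 - f j m =
    (-1) ^+ m *: (S ^+ m *m p (j + m)%N) + (-1) ^+ m *: (S ^+ m.+1 *m p (j + m).+1).
  by rewrite /f opprK addrC exprS mulN1r scaleNr opprK addnS.
have tel j : \sum_(0 <= m < D) ((-1) ^+ m *: (S ^+ m *m p (j + m)%N)
    + (-1) ^+ m *: (S ^+ m.+1 *m p (j + m).+1)) = f j D - f j 0.
  by apply: telescope_sumr_eq => // m _; rewrite fS.
rewrite -[RHS]fE -tel big_split /= -SqE; congr (_ + _).
case: k => [|k]; last by rewrite /lin_quot; apply: eq_bigr => m _; rewrite addSn.
apply/esym/eqP; rewrite -oppr_eq0 -sumrN; apply/eqP; apply: etrans p1.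
rewrite /tail_mul_neg big_add1 /=.
by apply: eq_bigr => m _; rewrite subn1 /= exprS mulN1r scaleNr.
Qed.

(** The derivative of (x + S) q is q + (x + S) dq/dx, and A (x + S) q = - q
    cancels its first term. *)
Lemma lowering_lin_mul q k : lowering (lin_mul q) k = lin_mul (deriv_seq q) k.
Proof.
rewrite /lowering tail_mul_pos_lin_mul /deriv_seq /lin_mul.
rewrite scalerDr addrAC -scalemxAr; congr (_ + _).
rewrite -natr1 scalerDl scale1r addrK.
by case: k => [|k //]; rewrite scale0r.
Qed.

Lemma iter_lowering_lin_mul q i k :
  iter i lowering (lin_mul q) k = lin_mul (iter i deriv_seq q) k.
Proof.
elim: i k => //= i IHi k.
by rewrite (lowering_ext (d := lin_mul (iter i deriv_seq q))) // lowering_lin_mul.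
Qed.

Lemma iter_deriv_seq q i k :
  iter i deriv_seq q k = ((k + i)`!%:R / k`!%:R) *: q (k + i)%N.
Proof.
elim: i k => [|i IHi] k /=; first by rewrite addn0 divff ?scale1r ?natr_fact_neq0.
rewrite /deriv_seq IHi scalerA addSnnS factS natrM; congr (_ *: _).
by field; rewrite natr_fact_neq0 nat1r pnatr_eq0.
Qed.

(** For p = (x + S) q, the i-th iterate is (x + S) q^(i), that is
    p^(i) - i q^(i-1); the right-hand side is its coefficient of x^k. *)
Lemma iter_loweringE p i k : (0 < D)%N -> tail_mul_neg p 1 = 0 -> (0 < i)%N ->
  iter i lowering p k = ((k + i).-1`!%:R / k`!%:R) *:
    (k%:R *: p (k + i)%N
     - i%:R *: \sum_(1 <= m < D) (-1) ^+ m *: (S ^+ m *m p (k + i + m)%N)).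
Proof.
move=> D0 p1; case: i => // i _.
rewrite -(eq_iter_lowering _ (fun j => lin_mulK j p1)).
rewrite iter_lowering_lin_mul addnS -[_.+1.-1]/(k + i)%N.
set R := \sum_(1 <= m < D) _.
have qE : lin_quot p (k + i)%N = p (k + i).+1 + R.
  by rewrite /lin_quot /R big_ltn // expr0 scale1r mul1mx addn0; congr (_ + _).
have SqE : S *m lin_quot p (k + i).+1 = - R.
  have := lin_mulK (k + i).+1 p1; rewrite /lin_mul qE -addrA => /(canRL (addKr _)).
  by rewrite addNr => /eqP; rewrite addrC addr_eq0 => /eqP.
clearbody R; rewrite /lin_mul; case: k qE SqE => [|k] qE SqE.
  rewrite (iter_deriv_seq _ i.+1 0) addnS -scalemxAr SqE scale0r !add0r.
  rewrite !scalerN scalerA.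
  by congr (- (_ *: _)); rewrite !add0n factS natrM; ring.
rewrite !iter_deriv_seq !addnS -scalemxAr SqE -addSn qE.
apply/matrixP => a b; rewrite !mxE.
have -> : (k.+1 + i).+1`!%:R = (k.+1%:R + i.+1%:R) * (k.+1 + i)`!%:R :> F.
  by rewrite factS natrM -natrD addnS.
rewrite factS natrM; move: (k.+1 + i)`!%:R => u.
by field; rewrite natr_fact_neq0 nat1r pnatr_eq0.
Qed.

End Lowering.

(** * The intertwining relation in coefficients *)

Section Intertwining.
Variables (F : numFieldType) (N D : nat) (S : 'M[F]_N).
Local Notation M := 'M[F]_N.
Implicit Types (b t q : nat -> M) (x z : F).

Definition tail_series x : M :=
  \sum_(1 <= m < D.+1) ((-1) ^+ m * x ^- m) *: S ^+ m.-1.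

(** Up to a power of x, the commutator of the m-th term of A with the j-th
    term of t; the coefficients of x^k and of x^-r in [A, t] follow. *)
Definition tail_comm t (m j : nat) : M :=
  (-1) ^+ m *: (S ^+ m.-1 *m t j - t j *m S ^+ m.-1).

Definition tail_comm_pos t (k : nat) : M :=
  \sum_(1 <= m < D.+1) tail_comm t m (k + m).

Definition tail_comm_neg t (r : nat) : M :=
  \sum_(r <= m < D.+1) tail_comm t m (m - r).

(** The polynomial part of dt/dx + [A, t]. *)
Definition defect t (k : nat) : M := deriv_seq t k + tail_comm_pos t k.

(** Multiplication by x^r moves the coefficient of x^-r to the constant term. *)
Lemma tail_comm_pos_shift t u r : (1 <= r)%N ->
  (forall j, u j = if (j < r)%N then 0 else t (j - r)%N) ->
  tail_comm_pos u 0 = tail_comm_neg t r.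
Proof.
move=> r1 uE.
rewrite /tail_comm_pos /tail_comm_neg [RHS](big_nat_widenl _ 1) // [RHS]big_mkcond /=.
apply: eq_bigr => m _; rewrite /tail_comm add0n uE ltnNge.
by case: leqP => //= _; rewrite mulmx0 mul0mx subrr scaler0.
Qed.

Lemma tail_comm_neg1_const t : (forall j, (0 < j)%N -> t j = 0) ->
  tail_comm_neg t 1 = 0.
Proof.
move=> t0; rewrite /tail_comm_neg big_nat big1 // => m /andP[m1 _].
rewrite /tail_comm; have [->|m_neq1] := eqVneq m 1%N.
  by rewrite expr0 mul1mx mulmx1 subrr scaler0.
by rewrite t0 ?mulmx0 ?mul0mx ?subrr ?scaler0 // subn_gt0 ltn_neqAle eq_sym m_neq1.
Qed.

Lemma tail_mul_negE q r : (1 <= r <= D)%N -> tail_mul_neg D S q r =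
  (-1) ^+ r *: \sum_(0 <= k < (D - r).+1)
     (-1) ^+ k *: (S ^+ (k + D - (D - r) - 1) *m q k).
Proof.
move=> /andP[r1 rD]; rewrite /tail_mul_neg -{1}[r]add0n big_addn subSn // scaler_sumr.
apply: eq_bigr => k _; rewrite scalerA -exprD (addnC r k) addnK.
by congr (_ *: (S ^+ _ *m _)); lia.
Qed.

Lemma tail_mul_neg_eq0 q : (0 < D)%N ->
  (forall r, (1 <= r <= D)%N -> tail_mul_neg D S q r = 0) <->
  (forall s, (s <= D - 1)%N ->
     \sum_(0 <= k < s.+1) (-1) ^+ k *: (S ^+ (k + D - s - 1) *m q k) = 0).
Proof.
move=> D0; have sgn0 r (X : M) : (-1) ^+ r *: X = 0 -> X = 0.
  move=> /(congr1 (fun Y => (-1) ^+ r *: Y)).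
  by rewrite scaler0 scalerA -expr2 sqrr_sign scale1r.
split=> [H s sD | H r /[dup] rD /andP[r1 r2]].
  have sD' : (1 <= D - s <= D)%N by apply/andP; split; lia.
  by have /sgn0 := etrans (esym (tail_mul_negE q sD')) (H _ sD'); rewrite subKn //; lia.
by rewrite tail_mul_negE // H ?scaler0 // ?leq_sub2l.
Qed.

(** (z + A) b + db/dx - t (z + A), grouped by powers of x.  The left-hand side
    contains A b - t A = A (b - t) + [A, t], so that b enters the right-hand
    side through b - t only. *)
Lemma intertwine_expand (n : nat) b t x z : x != 0 ->
  (forall k, (n <= k)%N -> b k = 0) -> (forall k, (n <= k)%N -> t k = 0) ->
  \sum_(0 <= j < n)
     (x ^+ j *: (z%:M + tail_series x) + (j%:R * x ^+ j.-1)%:M) *m b j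
  - (\sum_(0 <= j < n) x ^+ j *: t j) *m (z%:M + tail_series x)
  = \sum_(0 <= k < n) x ^+ k *:
      (z *: (b k - t k) + lowering D S (fun j => b j - t j) k + defect t k)
    + \sum_(1 <= r < D.+1) x ^- r *:
      (tail_mul_neg D S (fun j => b j - t j) r + tail_comm_neg t r).
Proof.
move=> x0 bn tn.
pose h m j : M := (-1) ^+ m *: (S ^+ m.-1 *m b j - t j *m S ^+ m.-1).
have hE m j : h m j = (-1) ^+ m *: (S ^+ m.-1 *m (b j - t j)) + tail_comm t m j.
  by rewrite /h /tail_comm -scalerDr mulmxBr addrA subrK.
have h0 m j : (n <= j)%N -> h m j = 0.
  by move=> nj; rewrite /h bn ?tn // mulmx0 mul0mx subrr scaler0.
have := laurent_split D x0 h0.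
set U := \sum_(0 <= j < n) _; set V := _ + _ => UV.
have dE : \sum_(0 <= j < n) (j%:R * x ^+ j.-1) *: b j =
          \sum_(0 <= k < n) x ^+ k *: deriv_seq b k.
  case: n bn tn h0 U V UV => [|n] bn tn h0 U V UV; first by rewrite !big_geq.
  rewrite big_ltn // mul0r scale0r add0r big_add1 /= [RHS]big_nat_recr //=.
  rewrite {2}/deriv_seq bn // scaler0 scaler0 addr0.
  by apply: eq_bigr => j _; rewrite /deriv_seq scalerA mulrC.
transitivity (\sum_(0 <= k < n) x ^+ k *: (z *: (b k - t k) + deriv_seq b k) + V).
  rewrite -UV /U mulmx_suml -sumrB.
  have -> : \sum_(0 <= k < n) x ^+ k *: (z *: (b k - t k) + deriv_seq b k) =
      \sum_(0 <= k < n) x ^+ k *: (z *: (b k - t k))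
      + \sum_(0 <= j < n) (j%:R * x ^+ j.-1) *: b j.
    by rewrite dE -big_split; apply: eq_bigr => k _; rewrite scalerDr.
  rewrite -!big_split /=; apply: eq_bigr => j _.
  rewrite mulmxDl mul_scalar_mx [LHS]addrAC [RHS]addrAC; congr (_ + _).
  rewrite -!scalemxAl -[LHS]scalerBr -[RHS]scalerDr; congr (_ *: _).
  rewrite mulmxDl mulmxDr mul_scalar_mx mul_mx_scalar opprD addrACA -scalerBr.
  congr (_ + _).
  rewrite mulmx_suml mulmx_sumr -sumrB; apply: eq_bigr => m _.
  by rewrite -scalemxAl -scalemxAr -scalerBr scalerA mulrC.
rewrite /V addrA -big_split /=; congr (_ + _); apply: eq_bigr => k _.
  rewrite -scalerDr; congr (_ *: _); rewrite -!addrA; congr (_ + _).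
  rewrite /lowering /defect /tail_mul_pos /tail_comm_pos addrA addrACA -big_split /=.
  congr (_ + _); first by rewrite /deriv_seq -scalerDr subrK.
  by apply: eq_bigr => m _; rewrite hE.
congr (_ *: _); rewrite /tail_mul_neg /tail_comm_neg -big_split /=.
by apply: eq_bigr => m _; rewrite hE.
Qed.

Definition coef_solution t z b :=
  (forall k, z *: (b k - t k) + lowering D S (fun j => b j - t j) k = - defect t k) /\
  (forall r, (1 <= r <= D)%N ->
     tail_mul_neg D S (fun j => b j - t j) r = - tail_comm_neg t r).

Lemma intertwine_coefs (n : nat) b t z :
  (forall k, (n <= k)%N -> b k = 0) -> (forall k, (n <= k)%N -> t k = 0) ->
  (forall x, x != 0 ->
    \sum_(0 <= j < n)
       (x ^+ j *: (z%:M + tail_series x) + (j%:R * x ^+ j.-1)%:M) *m b j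
    = (\sum_(0 <= j < n) x ^+ j *: t j) *m (z%:M + tail_series x)) <->
  coef_solution t z b.
Proof.
move=> bn tn; split=> [H | [Hp Hn] x x0].
  have [E G] := laurent_eq0 (fun x nz_x =>
    etrans (esym (@intertwine_expand n b t x z nz_x bn tn))
      (etrans (congr1 (fun X => X - _) (H x nz_x)) (subrr _))).
  split=> [k|r rD]; last by apply/eqP; rewrite -addr_eq0 G.
  apply/eqP; rewrite -addr_eq0; have [kn|nk] := ltnP k n; first by rewrite E.
  have Z j : (k <= j)%N -> (b j = 0) * (t j = 0).
    by move=> kj; rewrite bn ?tn // (leq_trans nk).
  rewrite /defect /lowering /tail_mul_pos /tail_comm_pos /deriv_seq.
  rewrite !Z ?leqnSn // !subr0 !scaler0 !add0r -big_split /= big1 // => m _.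
  by rewrite /tail_comm !Z ?leq_addr // subr0 mulmx0 mul0mx subr0 !scaler0 addr0.
apply/eqP; rewrite -subr_eq0 (intertwine_expand _ x0 bn tn); apply/eqP.
rewrite big1 ?add0r => [|k _]; last by rewrite Hp addNr scaler0.
by rewrite big_nat big1 // => r rD; rewrite Hn // addNr scaler0.
Qed.

(** * Solving the coefficient equations *)

Section Solution.
Variables (t : nat -> M) (s : nat).
Hypothesis ts : forall k, (s <= k)%N -> t k = 0.

Lemma defect0 k : (s <= k)%N -> defect t k = 0.
Proof.
move=> sk; rewrite /defect /deriv_seq ts ?scaler0 ?add0r ?leqW //.
rewrite /tail_comm_pos big1 // => m _.
by rewrite /tail_comm ts ?mulmx0 ?mul0mx ?subrr ?scaler0 // (leq_trans sk) ?leq_addr.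
Qed.

Definition solution z (k : nat) : M := t k + resolvent D S s z (defect t) k.

Lemma solutionB z k : solution z k - t k = resolvent D S s z (defect t) k.
Proof. by rewrite /solution addrC addKr. Qed.

Lemma solution0 z k : (s <= k)%N -> solution z k = 0.
Proof. by move=> sk; rewrite /solution ts // add0r (resolvent0 _ _ _ defect0). Qed.

Lemma coef_solution_unique n z b : z != 0 -> (forall k, (n <= k)%N -> b k = 0) ->
  coef_solution t z b -> b =1 solution z.
Proof.
move=> z0 bn [H _] k; apply/eqP; rewrite /solution addrC -subr_eq; apply/eqP.
apply: (@add_lowering_inj _ _ D S z (fun j => b j - t j)
  (resolvent D S s z (defect t)) (maxn n s)) => // j.
- by rewrite geq_max => /andP[nj sj]; rewrite bn // ts // subrr.
- by rewrite geq_max => /andP[nj sj]; apply: resolvent0 => //; apply: defect0.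
by rewrite H resolventP //; apply: defect0.
Qed.

Lemma tail_mul_neg_solution z r :
  tail_mul_neg D S (fun j => solution z j - t j) r =
  \sum_(0 <= i < s) ((-1) ^+ i.+1 * z ^- i.+1) *:
     tail_mul_neg D S (iter i (lowering D S) (defect t)) r.
Proof.
rewrite -tail_mul_neg_sum; apply: eq_tail_mul_neg => j.
by rewrite solutionB.
Qed.

(** The defect is (x + S) q for some q, and its iterated images are
    (x + S) q^(i); A times any of them is a polynomial. *)
Lemma solutionP z : S ^+ D = 0 -> (0 < D)%N -> z != 0 ->
  (forall r, (1 <= r <= D)%N -> tail_comm_neg t r = 0) ->
  tail_mul_neg D S (defect t) 1 = 0 ->
  coef_solution t z (solution z).
Proof.
move=> SD D0 z0 tc p1; split=> [k | r rD].
  rewrite solutionB (@lowering_ext _ _ D S _ (resolvent D S s z (defect t))).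
    by apply: resolventP => //; apply: defect0.
  by move=> j _; rewrite solutionB.
rewrite tc // oppr0 tail_mul_neg_solution big1 // => i _.
rewrite -(eq_tail_mul_neg D S (eq_iter_lowering D S i (fun j => lin_mulK SD j p1))).
rewrite (eq_tail_mul_neg D S (iter_lowering_lin_mul SD _ i)).
by rewrite tail_mul_neg_lin_mul // scaler0.
Qed.

(** The equations at the negative powers of x are polynomial in z^-1, with
    constant coefficient [A, t]_- and linear coefficient - (A p)_-, where p is
    the defect of t. *)
Lemma solution_obstruction (u : nat -> F) : injective u -> (forall i, u i != 0) ->
  (forall i, coef_solution t (u i) (solution (u i))) ->
  (forall r, (1 <= r <= D)%N -> tail_comm_neg t r = 0) /\
  (forall r, (1 <= r <= D)%N -> tail_mul_neg D S (defect t) r = 0).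
Proof.
move=> u_inj u0 H.
suff Z r : (1 <= r <= D)%N ->
    tail_comm_neg t r = 0 /\ tail_mul_neg D S (defect t) r = 0.
  by split=> r /Z[].
move=> rD.
pose e i : M := if i is i'.+1 then
   (-1) ^+ i *: tail_mul_neg D S (iter i' (lowering D S) (defect t)) r
   else tail_comm_neg t r.
have e0 i : (i < s.+1)%N -> e i = 0.
  apply: (power_sum_eq0 (u := fun k => (u k)^-1)) => [k l /invr_inj /u_inj //|k].
  have [_ /(_ r rD)] := H k.
  rewrite tail_mul_neg_solution => /eqP; rewrite -addr_eq0 => /eqP Hk.
  rewrite -[RHS]Hk big_nat_recl // expr0 scale1r addrC; congr (_ + _).
  by apply: eq_bigr => j _; rewrite /e scalerA mulrC exprVn.
split; first exact: (e0 0%N).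
case: (posnP s) => [s0|s0].
  rewrite /tail_mul_neg big1 // => m _.
  by rewrite defect0 ?mulmx0 ?scaler0 ?s0.
have := e0 1%N s0.
by rewrite /e expr1 scaleN1r => /eqP; rewrite oppr_eq0 => /eqP.
Qed.

Lemma solutionE z j : S ^+ D = 0 -> (0 < D)%N ->
  tail_mul_neg D S (defect t) 1 = 0 ->
  solution z j = t j - z^-1 *: defect t j
  + \sum_(1 <= i < s) ((-1) ^+ i.+1 * z ^- i.+1 * ((j + i).-1`!%:R / j`!%:R)) *:
        (j%:R *: defect t (j + i)
         - i%:R *: \sum_(1 <= m < D)
                     (-1) ^+ m *: (S ^+ m *m defect t (j + i + m)%N)).
Proof.
move=> SD D0 p1; rewrite /solution /resolvent.
case: (posnP s) => [s0|s0].
  by rewrite !big_geq ?s0 // defect0 ?s0 // scaler0 subr0.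
rewrite big_ltn // addrA expr1 mulN1r scaleNr; congr (_ + _).
apply: eq_big_nat => i /andP[i1 _].
by rewrite iter_loweringE // scalerA.
Qed.

End Solution.
End Intertwining.

(** * Complex differentiation *)

Section NumFieldDerivatives.
Variable K : numFieldType.
Implicit Types (f : K -> K) (a d v w x z : K).

Lemma is_derive_first_order f a d :
  is_derive a 1 f d <->
  forall e, 0 < e ->
    \forall h \near 0, `|f (h + a) - f a - h * d| <= e * `|h|.
Proof.
split=> [[df dE] e e0|H].
  have /derivable_nbhs /eqaddoP /(_ e e0) := df.
  apply: filterS => h /=.
  by rewrite /= !fctE dE -[h *: 1]/(h * 1) mulr1 opprD addrA.
have key : h^-1 *: (f (h *: 1 + a) - f a) @[h --> 0^'] --> d.
  apply/cvgrPdist_le => e e0.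
  have /(_ e e0) := H; rewrite near_withinE; apply: filterS => h Hh h0.
  rewrite -[h *: 1]/(h * 1) mulr1.
  have -> : d - h^-1 *: (f (h + a) - f a) = - (h^-1 * (f (h + a) - f a - h * d)).
    by rewrite mulrBr mulKf // opprB.
  rewrite normrN normrM normfV ler_pdivrMl ?normr_gt0 // [leRHS]mulrC.
  exact: Hh.
apply: DeriveDef; last exact: cvg_lim key.
by apply/cvg_ex; exists d.
Qed.

Lemma is_derive_dilation f x a d :
  x != 0 -> is_derive (x * a) 1 f d -> is_derive a 1 (fun w => f (x * w)) (x * d).
Proof.
move=> x0 /is_derive_first_order df; apply/is_derive_first_order => e e0.
have xn : 0 < `|x| by rewrite normr_gt0.
have /(_ (e / `|x|)) := df; rewrite divr_gt0 // => /(_ isT) dfe.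
have x_to0 : (fun h : K => x * h) @ nbhs 0 --> nbhs (0 : K).
  by rewrite -[X in _ --> nbhs X](mulr0 x); exact: mulrl_continuous.
have : \forall h \near 0,
    `|f (x * h + x * a) - f (x * a) - x * h * d| <= e / `|x| * `|x * h|.
  exact: x_to0 _ dfe.
apply: filterS => h.
have -> : e / `|x| * `|x * h| = e * `|h| by rewrite normrM mulrA divfK ?gt_eqF.
by rewrite -mulrDr -mulrA mulrCA.
Qed.

Lemma derivable_expr f v (n : nat) :
  derivable f v 1 -> derivable (fun w => f w ^+ n) v 1.
Proof.
move=> df; elim: n => [|n IHn]; first exact: derivable_cst.
have := derivableM df IHn.
by rewrite (_ : _ * _ = fun w => f w ^+ n.+1) //; apply/funext => w; rewrite exprS.
Qed.

Lemma derivable_sum_expV (n : nat) (c : nat -> K) v : v != 0 ->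
  derivable (fun w => \sum_(0 <= i < n) w^-1 ^+ i * c i) v 1.
Proof.
move=> v0; have dV : derivable (fun w : K => w^-1) v 1.
  by apply: derivableV => //; exact: derivable_id.
elim: n => [|n IHn].
  rewrite (_ : (fun _ => _) = cst 0); first exact: derivable_cst.
  by apply/funext => w; rewrite big_geq.
have dn : derivable (fun w => w^-1 ^+ n * c n) v 1.
  have := derivableM (derivable_expr (n := n) dV) (derivable_cst (c n) v 1).
  by rewrite (_ : _ * _ = fun w => w^-1 ^+ n * c n).
have := derivableD IHn dn.
rewrite (_ : _ + _ = fun w => \sum_(0 <= i < n.+1) w^-1 ^+ i * c i) //.
by apply/funext => w; rewrite big_nat_recr.
Qed.

Lemma near_neq w z : w != z -> \forall v \near w, v != z.
Proof.
move=> wz; apply/nbhs_ballP; exists `|w - z|; first by rewrite /= normr_gt0 subr_eq0.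
move=> v /=; rewrite -ball_normE /=; apply: contraTneq => ->.
by rewrite ltxx.
Qed.

Lemma dnbhs_injective_seq a (Q : K -> Prop) :
  (\forall w \near a^', Q w) -> exists2 u : nat -> K, injective u & forall k, Q (u k).
Proof.
rewrite near_withinE => /nbhs_ballP[e /= e0 He].
have e2 : e / 2 != 0 by rewrite mulf_neq0 ?invr_eq0 ?pnatr_eq0 ?gt_eqF.
(* Halving e keeps even the first point inside the open ball. *)
exists (fun k => a + e / 2 / k.+1%:R) => [k l /addrI /(mulfI e2) /invr_inj /eqP | k].
  by rewrite eqr_nat eqSS => /eqP.
apply: He; last by rewrite -subr_eq0 addrC addKr mulf_neq0 // invr_eq0 pnatr_eq0.
rewrite -ball_normE /= opprD addNKr normrN !normrM !normfV normr_nat (gtr0_norm e0).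
rewrite ger0_norm // ltr_pdivrMr ?ltr0n // ltr_pdivrMr ?ltr0n //.
rewrite -mulrA ltr_pMr // -natrM ltr1n; lia.
Qed.

End NumFieldDerivatives.

Section ComplexExponential.
Variable R : realType.
Local Notation C := (complexField R).

Lemma expC0 : expC (0 : C) = 1.
Proof. by rewrite /expC /= expR0 cos0 sin0 mulr0 mulr1. Qed.

Lemma expCD (z w : C) : expC (z + w) = expC z * expC w.
Proof.
case: z => a b; case: w => c d; rewrite /expC /= expRD cosD sinD.
by apply/eqP; rewrite eq_complex /=; apply/andP; split; apply/eqP; ring.
Qed.

Lemma expC_neq0 (z : C) : expC z != 0.
Proof.
apply/eqP => z0; have := expCD z (- z).
by rewrite subrr expC0 z0 mul0r => /eqP; rewrite oner_eq0.
Qed.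

Lemma normC_le (a b : R) : `|(Complex a b : C)| <= real_complex R (`|a| + `|b|).
Proof.
rewrite normc_def lecR -(@ger0_norm _ (`|a| + `|b|)) ?addr_ge0 //=.
rewrite -sqrtr_sqr ler_wsqrtr // sqrrD !real_normK ?num_real //.
rewrite -addrA lerD2l lerDr -mulr_natl mulr_ge0 // mulr_ge0 //.
Qed.

Lemma normRe_le (z : C) : real_complex R `|complex.Re z| <= `|z|.
Proof. by rewrite normc_def lecR -sqrtr_sqr ler_wsqrtr // lerDl sqr_ge0. Qed.

Lemma normIm_le (z : C) : real_complex R `|complex.Im z| <= `|z|.
Proof. by rewrite normc_def lecR -sqrtr_sqr ler_wsqrtr // lerDr sqr_ge0. Qed.

Lemma near_ReIm (Q : R -> Prop) : (\forall t \near 0, Q t) ->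
  \forall h \near (0 : C), Q (complex.Re h) /\ Q (complex.Im h).
Proof.
move=> /nbhs_ballP[e /= e0 He].
apply/nbhs_ballP; exists (real_complex R e); first by rewrite /= ltcR.
move=> h /=; rewrite /= sub0r normrN => hh.
split; apply: He; rewrite -ball_normE /= sub0r normrN -ltcR.
  exact: le_lt_trans (normRe_le h) hh.
exact: le_lt_trans (normIm_le h) hh.
Qed.

(** The real and imaginary parts of exp h - 1 - h, for h = a + i b, are
    combinations of the three one-variable remainders and of the product a b,
    which is itself of second order. *)
Lemma expC_first_order (a b e : R) :
    0 <= e -> e <= 1 -> `|a| <= e ->
    `|expR a - 1 - a| <= e * `|a| ->
    `|cos b - 1| <= e * `|b| -> `|sin b - b| <= e * `|b| ->
  `|expR a * cos b - 1 - a| + `|expR a * sin b - b| <= 8 * e * (`|a| + `|b|).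
Proof.
move=> e0 e1 ae H1 H2 H3.
have cle : `|cos b| <= 1 by rewrite ler_norml cos_geN1 cos_le1.
have sle : `|sin b| <= 1 by rewrite ler_norml sin_geN1 sin_le1.
have m1 : `|a * (cos b - 1)| <= e * `|b|.
  rewrite normrM; apply: le_trans (_ : 1 * (e * `|b|) <= _); last by rewrite mul1r.
  by apply: ler_pM => //; apply: le_trans ae e1.
have m2 : `|a * (sin b - b)| <= e * `|b|.
  rewrite normrM; apply: le_trans (_ : 1 * (e * `|b|) <= _); last by rewrite mul1r.
  by apply: ler_pM => //; apply: le_trans ae e1.
have m3 : `|a * b| <= e * `|b| by rewrite normrM ler_wpM2r.
have m4 : `|(expR a - 1 - a) * cos b| <= e * `|a|.
  by rewrite normrM -[leRHS]mulr1 ler_pM.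
have m5 : `|(expR a - 1 - a) * sin b| <= e * `|a|.
  by rewrite normrM -[leRHS]mulr1 ler_pM.
have -> : expR a * cos b - 1 - a =
   (expR a - 1 - a) * cos b + (cos b - 1) + a * (cos b - 1) by ring.
have -> : expR a * sin b - b =
   (expR a - 1 - a) * sin b + (sin b - b) + (a * (sin b - b) + a * b) by ring.
have t1 := ler_normD ((expR a - 1 - a) * cos b + (cos b - 1)) (a * (cos b - 1)).
have t2 := ler_normD ((expR a - 1 - a) * cos b) (cos b - 1).
have t3 := ler_normD ((expR a - 1 - a) * sin b + (sin b - b)) (a * (sin b - b) + a * b).
have t4 := ler_normD ((expR a - 1 - a) * sin b) (sin b - b).
have t5 := ler_normD (a * (sin b - b)) (a * b).
have a0 : 0 <= e * `|a| by rewrite mulr_ge0.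
have b0 : 0 <= e * `|b| by rewrite mulr_ge0.
lra.
Qed.

(** The functional equation moves the base point to 0, where the derivative is
    read off the real derivatives of exp, cos and sin. *)
Lemma is_derive_expC (z : C) : is_derive z 1 (@expC R) (expC z).
Proof.
suff D0 : is_derive (0 : C) 1 (@expC R) 1.
  apply/is_derive_first_order => e e0.
  have n0 : 0 < `|expC z| by rewrite normr_gt0 expC_neq0.
  move/is_derive_first_order : D0 => /(_ (e / `|expC z|)).
  rewrite divr_gt0 // => /(_ isT).
  apply: filterS => h; rewrite addr0 expC0 mulr1 => Hh.
  have -> : expC (h + z) - expC z - h * expC z = (expC h - 1 - h) * expC z.
    by rewrite expCD !mulrBl mul1r.
  by rewrite normrM -ler_pdivlMr // mulrAC.
apply/is_derive_first_order => e e0.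
have eR : e = real_complex R (complex.Re e) by rewrite RRe_real // gtr0_real.
have e0' : 0 < complex.Re e by rewrite -ltcR -eR.
(* 16 pays for the constant 8 of the first-order bound and for
   |Re h| + |Im h| <= 2 |h|. *)
set d := Num.min 1 (complex.Re e / 16).
have d0 : 0 < d by rewrite lt_min ltr01 divr_gt0.
have /(near_ReIm) N1 : \forall t \near (0 : R), [/\ `|t| <= d,
    `|expR t - 1 - t| <= d * `|t|,
    `|cos t - 1| <= d * `|t| & `|sin t - t| <= d * `|t|].
  have h1 : \forall t \near (0 : R), `|t| <= d.
    apply/nbhs_ballP; exists d => //= t; rewrite -ball_normE /= sub0r normrN.
    exact: ltW.
  have /is_derive_first_order /(_ d d0) h2 := is_derive_expR (0 : R).
  have /is_derive_first_order /(_ d d0) h3 := is_derive_cos (0 : R).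
  have /is_derive_first_order /(_ d d0) h4 := is_derive_sin (0 : R).
  near=> t; split.
  - by near: t.
  - have : `|expR (t + 0) - expR 0 - t * expR 0| <= d * `|t| by near: t.
    by rewrite addr0 expR0 mulr1.
  - have : `|cos (t + 0) - cos 0 - t * - sin 0| <= d * `|t| by near: t.
    by rewrite addr0 cos0 sin0 oppr0 mulr0 subr0.
  - have : `|sin (t + 0) - sin 0 - t * cos 0| <= d * `|t| by near: t.
    by rewrite addr0 cos0 sin0 mulr1 subr0.
apply: filterS N1 => h [[? ? _ _] [_ _ ? ?]].
rewrite addr0 expC0 mulr1.
have d1 : d <= 1 by rewrite ge_min lexx.
have bound := @expC_first_order (complex.Re h) (complex.Im h) d (ltW d0) d1.
have : `|expR (complex.Re h) * cos (complex.Im h) - 1 - complex.Re h| +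
   `|expR (complex.Re h) * sin (complex.Im h) - complex.Im h| <=
   8 * d * (`|complex.Re h| + `|complex.Im h|) by apply: bound.
rewrite -lecR => K.
have expCB (w : C) : expC w - 1 - w = Complex
   (expR (complex.Re w) * cos (complex.Im w) - 1 - complex.Re w)
   (expR (complex.Re w) * sin (complex.Im w) - complex.Im w).
  by case: w => u v; apply/eqP; rewrite eq_complex /= oppr0 addr0 !eqxx.
rewrite expCB.
apply: le_trans (normC_le _ _) _; apply: le_trans K _.
have Q : real_complex R (`|complex.Re h| + `|complex.Im h|) <= 2 * `|h|.
  by rewrite rmorphD /= mulrDl mul1r lerD ?normRe_le ?normIm_le.
rewrite [e in leRHS]eR rmorphM /=.
apply: le_trans (ler_wpM2l _ Q) _; first by rewrite ler0c mulr_ge0 // ltW.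
rewrite mulrA ler_wpM2r // -(rmorph_nat (real_complex R) 2) -rmorphM /= lecR.
have : d <= complex.Re e / 16 by rewrite ge_min lexx orbT.
lra.
Unshelve. all: by end_near.
Qed.

Lemma derive1_expC_affine (x a b : C) : x != 0 ->
  derive1 (fun w => expC (x * w) * (a * w + b)) =
  (fun w => expC (x * w) * (x * (a * w + b) + a)).
Proof.
move=> x0; apply/funext => z; rewrite derive1E.
have d1 := is_derive_dilation x0 (is_derive_expC (x * z)).
have d2 : is_derive z 1 (fun w : C => a * w + b) a.
  apply/is_derive_first_order => e e0; near=> h.
  have -> : a * (h + z) + b - (a * z + b) - h * a = 0 by ring.
  by rewrite normr0 mulr_ge0 // ltW.
have [_ ->] := is_deriveM d1 d2.
rewrite -[_ *: a]/(_ * a) -[_ *: (x * _)]/(_ * (x * _)); ring.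
Unshelve. all: by end_near.
Qed.

Lemma derive1n_expC_affine (x a b : C) (j : nat) : x != 0 ->
  derive1n j (fun w => expC (x * w) * (a * w + b)) =
  (fun w => expC (x * w) * (x ^+ j * (a * w + b) + j%:R * x ^+ j.-1 * a)).
Proof.
move=> x0; elim: j => [|j IHj].
  by apply/funext => w; rewrite derive1n0 !mul0r addr0 expr0 mul1r.
rewrite derive1nS IHj.
have -> : (fun w => expC (x * w) * (x ^+ j * (a * w + b) + j%:R * x ^+ j.-1 * a)) =
  (fun w => expC (x * w) *
     ((x ^+ j * a) * w + (x ^+ j * b + j%:R * x ^+ j.-1 * a))).
  by apply/funext => w; congr (_ * _); ring.
rewrite derive1_expC_affine //; apply/funext => w; congr (_ * _).
have xj : j%:R * x ^+ j = x * (j%:R * x ^+ j.-1) :> C.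
  by case: j {IHj} => [|j]; rewrite ?mul0r ?mulr0 // exprS /=; ring.
rewrite /= -natr1 mulrDl mul1r exprS xj; ring.
Qed.

End ComplexExponential.

(** * Meromorphic functions and operators *)

Section Meromorphic.
Variable R : realType.
Local Notation C := (complexField R).

Lemma holomorphic_meromorphic (f : C -> C) (z : C) :
  holomorphic_at f z -> meromorphic_at f z.
Proof.
move=> hf; exists 0%N, f; split=> //; apply: filterE => w.
by rewrite expr0 divr1.
Qed.

Lemma meromorphic_near_holomorphic (f : C -> C) (z : C) :
  meromorphic_at f z -> \forall w \near z^', holomorphic_at f w.
Proof.
(* Holomorphy at w, and f = g / (_ - z)^n near each v near w, are statements
   about neighbourhoods of points near z: hence the repeated near_join. *)
move=> [n [g [hg]]]; rewrite !near_withinE => /near_join/near_join hf.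
have {}hg := near_join hg.
near=> w => wz.
have vz : \forall v \near w, v != z by exact: near_neq.
near=> v.
have vz0 : v != z by near: v.
apply: (@near_eq_derivable _ _ _ (fun u => g u * ((u - z) ^+ n)^-1)).
  have : \forall u \near v, u != z -> f u = g u / (u - z) ^+ n.
    by near: v; near: w.
  have : \forall u \near v, u != z by exact: near_neq.
  by apply: filterS2 => u uz ->.
apply: derivableM; first by near: v; near: w.
apply: derivableV; first by rewrite expf_neq0 // subr_eq0.
apply: derivable_expr.
by apply: derivableB; [exact: derivable_id | exact: derivable_cst].
Unshelve. all: by end_near.
Qed.

Lemma near_regular_point (N : nat) (B : diffop R N) : meromorphic_op B ->
  exists a : C, \forall z \near a^', regular_point B z.
Proof.
move=> [Bo [a Ba] Bm]; exists a.
have dom : \forall z \near a^', op_dom B z.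
  by apply: nbhs_dnbhs; apply: open_nbhs_nbhs.
have hol : \forall z \near a^', forall (j : 'I_(op_order B).+1) (i k : 'I_N),
    holomorphic_at (fun w => op_coef B j w i k) z.
  apply: filter_forall => j; apply: filter_forall => i; apply: filter_forall => k.
  by apply: meromorphic_near_holomorphic; apply: Bm => //; rewrite -ltnS.
apply: filterS2 dom hol => z zB zh; split=> // j jB i k.
exact: (zh (Ordinal (jB : (j < (op_order B).+1)%N))).
Qed.

End Meromorphic.

(** * The conditions defining Gamma in terms of coefficients *)

Section Bispectral.
Variables (R : realType) (N D : nat).
Local Notation C := (complexField R).
Variable S : 'M[C]_N.
Implicit Types (theta : 'M[{poly C}]_N) (B : diffop R N).

Definition mxcoef theta (j : nat) : 'M[C]_N := map_mx (fun p : {poly C} => p`_j) theta.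

Lemma mxderiv0E theta j : mxderiv0 theta j = j`!%:R *: mxcoef theta j.
Proof.
apply/matrixP => a b; rewrite !mxE horner_coef0 coef_derivn addn0 ffactnn.
by rewrite mulr_natl.
Qed.

Lemma mxderiv0K theta j : j`!%:R^-1 *: mxderiv0 theta j = mxcoef theta j.
Proof. by rewrite mxderiv0E scalerA mulVf ?scale1r ?natr_fact_neq0. Qed.

Lemma mxcoef0 theta j : (mxsize theta <= j)%N -> mxcoef theta j = 0.
Proof.
move=> sj; apply/matrixP => a b; rewrite !mxE nth_default // (leq_trans _ sj) //.
by apply: leq_trans (leq_bigmax a); apply: (leq_bigmax b).
Qed.

Lemma mxeval_sum theta x n : (mxsize theta <= n)%N ->
  mxeval theta x = \sum_(0 <= j < n) x ^+ j *: mxcoef theta j.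
Proof.
move=> sn; apply/matrixP => a b; rewrite mxE summxE.
rewrite (@horner_coef_wide _ n); last first.
  by apply: leq_trans sn; apply: leq_trans (leq_bigmax a); exact: (leq_bigmax b).
by rewrite big_mkord; apply: eq_bigr => j _; rewrite !mxE mulrC.
Qed.

Lemma P_defect theta k : P S D k theta = defect D S (mxcoef theta) k.
Proof.
rewrite /P /defect /deriv_seq mxderiv0E scalerA; congr (_ *: _ + _).
  by rewrite factS natrM mulrCA mulVf ?mulr1 ?natr_fact_neq0.
rewrite /tail_comm_pos; case: D => [|D']; first by rewrite !big_geq ?oppr0 ?addn0.
(* The term m = 1 of the commutator with A is a commutator with S^0. *)
rewrite [RHS]big_ltn // {1}/tail_comm expr0 mul1mx mulmx1 subrr scaler0 add0r.
have -> : (k + D'.+1).+1 = (D'.+2 + k)%N by lia.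
rewrite -[k.+2]/(2 + k)%N big_addn addnK -sumrN.
apply: eq_big_nat => m /andP[m1 _].
have -> : (-1) ^ (k%:Z - (m + k)%:Z) = (-1) ^+ m :> C.
  have -> : k%:Z - (m + k)%:Z = - m%:Z by lia.
  by rewrite -exprnN invr_sign.
by rewrite mxderiv0K addnK subn1 /tail_comm /commutator -scalerN opprB (addnC k).
Qed.

Lemma mxcoef_shift theta r j :
  mxcoef ('X^r *: theta) j = if (j < r)%N then 0 else mxcoef theta (j - r).
Proof. by apply/matrixP => a b; rewrite !mxE coefXnM; case: ifP; rewrite !mxE. Qed.

Lemma P0_shift theta r : (1 <= r)%N ->
  P S D 0 ('X^r *: theta) =
  (if r == 1%N then mxcoef theta 0 else 0) + tail_comm_neg D S (mxcoef theta) r.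
Proof.
move=> r1; have := mxcoef_shift theta r; move: ('X^r *: theta) => u uE.
rewrite P_defect /defect deriv_seq0 (uE 1%N) (tail_comm_pos_shift D S r1 uE).
by apply: f_equal2 => //; case: r r1 {uE} => [|[|r]].
Qed.

(** The two conditions on P_0 say that [A, theta] has no negative powers of x,
    the one on the alternating sums that A P has none. *)
Lemma GammaP theta : (0 < D)%N -> Gamma S D theta <->
  (forall r, (1 <= r <= D)%N -> tail_comm_neg D S (mxcoef theta) r = 0) /\
  (forall r, (1 <= r <= D)%N -> tail_mul_neg D S (defect D S (mxcoef theta)) r = 0).
Proof.
move=> D0.
have X1 : P S D 0 ('X *: map_mx polyC (mxeval theta 0)) = mxcoef theta 0.
  have E0 : mxcoef (map_mx polyC (mxeval theta 0)) 0 = mxcoef theta 0.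
    by apply/matrixP => a b; rewrite !mxE coefC horner_coef0.
  rewrite (P0_shift (map_mx polyC (mxeval theta 0)) (r := 1)) // E0.
  rewrite (tail_comm_neg1_const D S) => [|j j0]; first exact: addr0.
  by apply/matrixP => a b; rewrite !mxE coefC gtn_eqF.
have X1E : P S D 0 ('X *: theta) = mxcoef theta 0 + tail_comm_neg D S (mxcoef theta) 1.
  exact: (P0_shift theta (r := 1)).
have X2E j : (2 <= j)%N -> P S D 0 ('X^j *: theta) = tail_comm_neg D S (mxcoef theta) j.
  move=> j2; have := P0_shift theta (ltnW j2); rewrite (gtn_eqF j2) => ->.
  exact: add0r.
have PE s : \sum_(0 <= k < s.+1) (-1) ^+ k *: (S ^+ (k + D - s - 1) *m P S D k theta) =
  \sum_(0 <= k < s.+1) (-1) ^+ k *: (S ^+ (k + D - s - 1) *m defect D S (mxcoef theta) k).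
  by apply: eq_bigr => k _; rewrite P_defect.
split=> [[]|[H1 H2]].
  rewrite X1 X1E => G1 G2 G3.
  split=> [r /andP[r1 r2]|]; last first.
    by apply/tail_mul_neg_eq0 => // s sD; rewrite -PE G3.
  case: r r1 r2 => [|[|r]] // _ _; last by rewrite -X2E // G2.
  by apply: (addrI (mxcoef theta 0)); rewrite G1 addr0.
split.
- by rewrite X1 X1E H1 // addr0.
- move=> j j2; rewrite X2E //.
  have [jD|Dj] := leqP j D; first by rewrite H1 // (ltnW j2).
  by rewrite /tail_comm_neg big_geq.
by move=> q qD; rewrite PE; move/tail_mul_neg_eq0: H2; apply.
Qed.

(** * Intertwining operators *)

Lemma coefficient0 B j z : (op_order B < j)%N -> coefficient B j z = 0.
Proof. by rewrite /coefficient ltnNge => /negbTE ->. Qed.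

Lemma mx_derive_psi (j : nat) (x z : C) : x != 0 ->
  mx_derive j (psi S D x) z =
  expC (x * z) *: (x ^+ j *: (z%:M + tail_series D S x) + (j%:R * x ^+ j.-1)%:M).
Proof.
move=> x0; apply/matrixP => i k; rewrite mxE.
have -> : (fun w => psi S D x w i k) =
  (fun w => expC (x * w) * ((i == k)%:R * w + tail_series D S x i k)).
  by apply/funext => w; rewrite /psi !mxE mulr_natl.
rewrite derive1n_expC_affine // !mxE -(mulr_natr z) -(mulr_natr (j%:R * _)).
by congr (_ * _); ring.
Qed.

Lemma ract_psi B n x z : (op_order B < n)%N -> x != 0 ->
  ract (psi S D) B x z = expC (x * z) *:
    \sum_(0 <= j < n) (x ^+ j *: (z%:M + tail_series D S x)
      + (j%:R * x ^+ j.-1)%:M) *m coefficient B j z.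
Proof.
move=> Bn x0; rewrite (sum_trunc Bn) => [|j Bj]; last first.
  by rewrite coefficient0 // mulmx0.
rewrite /ract scaler_sumr; apply: eq_big_nat => j /andP[_ jB].
by rewrite mx_derive_psi // /coefficient -ltnS jB scalemxAl.
Qed.

Lemma intertwines_coefs B theta z :
  (forall x, x != 0 -> ract (psi S D) B x z = mxeval theta x *m psi S D x z) <->
  coef_solution D S (mxcoef theta) z (fun j => coefficient B j z).
Proof.
pose n := maxn (op_order B).+1 (mxsize theta).
have Bn : (op_order B < n)%N by rewrite leq_maxl.
have tn : (mxsize theta <= n)%N by rewrite leq_maxr.
have bn k : (n <= k)%N -> coefficient B k z = 0.
  by move=> nk; apply: coefficient0; apply: leq_trans nk.
have cn k : (n <= k)%N -> mxcoef theta k = 0.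
  by move=> nk; apply: mxcoef0; apply: leq_trans nk.
split=> [H | /(intertwine_coefs D S z bn cn) H x x0].
  apply/(intertwine_coefs D S z bn cn) => x x0.
  have := H x x0; rewrite (ract_psi z Bn x0) (mxeval_sum x tn) -scalemxAr.
  by move/(scalerI (expC_neq0 _)).
by rewrite (ract_psi z Bn x0) (mxeval_sum x tn) -scalemxAr H.
Qed.

Lemma coefficient_solution B theta z j : intertwines S D B theta -> z != 0 ->
  regular_point B z ->
  coefficient B j z = solution D S (mxcoef theta) (mxsize theta) z j.
Proof.
move=> BT z0 zB.
have /intertwines_coefs H : forall x, x != 0 ->
    ract (psi S D) B x z = mxeval theta x *m psi S D x z by move=> x x0; apply: BT.
apply: (coef_solution_unique (@mxcoef0 theta) z0 _ H (n := (op_order B).+1)) => k.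
exact: coefficient0.
Qed.

Hypothesis D0 : (0 < D)%N.

Lemma bispectral_Gamma theta : bispectral_algebra S D theta -> Gamma S D theta.
Proof.
move=> [B [Bm BT]]; have [a Ba] := near_regular_point Bm.
have a0 : \forall z \near a^', z != 0.
  have [->|a0] := eqVneq a 0; first exact: nbhs_dnbhs_neq.
  by apply: nbhs_dnbhs; apply: near_neq.
have {Ba a0} : \forall z \near a^', regular_point B z /\ z != 0.
  by apply: filterS2 Ba a0.
move=> /dnbhs_injective_seq [u u_inj uB].
apply/GammaP => //; apply: (solution_obstruction (@mxcoef0 theta) u_inj) => [i|i].
  by have [] := uB i.
have [uBi ui0] := uB i.
have /intertwines_coefs [H1 H2] : forall x, x != 0 ->
    ract (psi S D) B x (u i) = mxeval theta x *m psi S D x (u i).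
  by move=> x x0; apply: BT.
rewrite (_ : solution _ _ _ _ _ = fun j => coefficient B j (u i)) //.
by apply/funext => j; rewrite (coefficient_solution _ BT).
Qed.

(** * The explicit operator *)

Hypothesis SD0 : S ^+ D = 0.
Variable theta : 'M[{poly C}]_N.
Hypothesis Gtheta : Gamma S D theta.

Lemma explicit_coefE j z :
  explicit_coef S D theta j z = solution D S (mxcoef theta) (mxsize theta) z j.
Proof.
have /(GammaP theta D0) [_ /(_ 1%N D0) p1] := Gtheta.
have := solutionE (@mxcoef0 theta) z j SD0 D0 p1.
have <- : P S D ^~ theta = defect D S (mxcoef theta).
  by apply/funext => k; rewrite P_defect.
by move->; rewrite /explicit_coef mxderiv0K.
Qed.

Lemma coefficient_explicit j z :
  coefficient (explicit_op S D theta) j z =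
  solution D S (mxcoef theta) (mxsize theta) z j.
Proof.
rewrite /coefficient /= explicit_coefE //; case: leqP => // sj.
exact/esym/(solution0 D S (@mxcoef0 theta) z)/(leq_trans (leqSpred _) sj).
Qed.

(** The coefficients are polynomials in z^-1. *)
Lemma explicit_holomorphic j z : z != 0 ->
  mx_holomorphic_at (explicit_coef S D theta j) z.
Proof.
move=> z0 i k.
pose c l : C := if l is l'.+1 then
   (-1) ^+ l * iter l' (lowering D S) (defect D S (mxcoef theta)) j i k
   else mxcoef theta j i k.
have E : (fun w => explicit_coef S D theta j w i k) =
  (fun w : C => \sum_(0 <= l < (mxsize theta).+1) w^-1 ^+ l * c l).
  apply/funext => w; rewrite explicit_coefE // /solution mxE big_nat_recl //.
  rewrite expr0 mul1r /resolvent summxE; congr (_ + _); apply: eq_bigr => l _.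
  by rewrite mxE exprVn mulrCA mulrA.
rewrite /holomorphic_at E.
have : \forall w \near z, w != 0 by apply: near_neq.
by apply: filterS => w w0; apply: derivable_sum_expV.
Qed.

Lemma explicit_meromorphic : meromorphic_op (explicit_op S D theta).
Proof.
split.
- by rewrite openE => z z0; apply: near_neq.
- by exists 1; rewrite /= oner_eq0.
by move=> j _ z z0 i k; apply: holomorphic_meromorphic; apply: explicit_holomorphic.
Qed.

Lemma explicit_intertwines : intertwines S D (explicit_op S D theta) theta.
Proof.
move=> x z x0 [z0 _].
have /(GammaP theta D0) [tc p] := Gtheta.
have := solutionP (@mxcoef0 theta) SD0 D0 z0 tc (p 1%N D0).
rewrite (_ : solution _ _ _ _ _ = fun j => coefficient (explicit_op S D theta) j z).
  by move/intertwines_coefs; apply.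
by apply/funext => j; rewrite coefficient_explicit.
Qed.

End Bispectral.

Theorem theorem6 (R : realType) (N D : nat) (S : 'M[complexField R]_N)
    (hD : (2 <= D)%N) (hS : nilpotent_of_degree S D) :
  Gamma S D = bispectral_algebra S D /\
  (forall theta : 'M[{poly complexField R}]_N, bispectral_algebra S D theta ->
    [/\ meromorphic_op (explicit_op S D theta),
        intertwines S D (explicit_op S D theta) theta &
        forall B : diffop R N, meromorphic_op B -> intertwines S D B theta ->
          forall (j : nat) (z : complexField R),
            z != 0 -> regular_point B z ->
            coefficient B j z = coefficient (explicit_op S D theta) j z]).
Proof.
have [SD0 _] := hS; have D0 : (0 < D)%N by apply: ltnW.
split=> [|theta /(bispectral_Gamma D0) G].
  apply/seteqP; split=> theta; last exact: bispectral_Gamma.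
  move=> G; exists (explicit_op S D theta).
  by split; [apply: explicit_meromorphic | apply: explicit_intertwines].
split; [exact: explicit_meromorphic | exact: explicit_intertwines |].
move=> B _ BT j z z0 zB.
by rewrite (coefficient_solution _ BT) // coefficient_explicit.
Qed.
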